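(* Let $H$ be a polarization of type $(d_1,\ldots,d_g)$ on a complex torus $T$ of dimension $g\ge 1$, and let $\lambda_H\colon T\to\widehat T$ be the isogeny induced by $H$. Then $d_k=d_{2k}(\lambda_H)$ for $1\le k\le g$ and, in particular, $e(H)=d_{2g}(\lambda_H)$.
   Context: A complex torus of dimension $g$ is a quotient $T=V/L$ of a complex vector space $V$ of dimension $g$ by a lattice $L$ (a discrete subgroup of $V$ of rank $2g$ generating $V$ as a real vector space). A homomorphism $f\colon T_1=V_1/L_1\to T_2=V_2/L_2$ of complex tori (a holomorphic group homomorphism) is induced by a $\mathbb C$-linear map $\rho_a(f)\colon V_1\to V_2$ with $\rho_a(f)(L_1)\subseteq L_2$ (the analytic representation); its restriction $\rho_r(f)\colon L_1\to L_2$ is the rational representation. $[\rho_r(f)]$ denotes the integral matrix of $\rho_r(f)$, of size $2\dim T_2\times 2\dim T_1$, with respect to chosen $\mathbb Z$-bases of $L_1$ and $L_2$. For $k\ge 1$, the $k$-th determinantal divisor $\delta_k(f)$ is the (positive) greatest common divisor of the minors of order $k$ of $[\rho_r(f)]$ if at least one of them is non-zero, and $\delta_k(f)=0$ otherwise; also $\delta_0(f):=1$. These do not depend on the choice of bases. If $r$ is the rank of $[\rho_r(f)]$, set $d_k(f):=\delta_k(f)/\delta_{k-1}(f)\in\mathbb Z_{>0}$ for $1\le k\le r$. If $f$ is an isogeny (a surjective homomorphism with finite kernel), then $r=2\dim T_1$. A polarization on $T=V/L$ is a positive definite hermitian form $H$ on $V$ ($\mathbb C$-linear in the first variable, antilinear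 in the second) whose imaginary part $E=\mathrm{Im}\,H$ takes integral values on $L\times L$. There is a basis of $L$ in which the matrix of $E$ is $\begin{pmatrix}0&D\\-D&0\end{pmatrix}$ with $D=\mathrm{diag}(d_1,\ldots,d_g)$, $d_k\in\mathbb Z_{>0}$ and $d_k\mid d_{k+1}$ for $1\le k<g$; the integers $d_k$ are unique with this property. The vector $(d_1,\ldots,d_g)$ is the type of $H$ and $e(H):=d_g$ is the exponent of $H$. The dual torus is $\widehat T=\overline\Omega/\widehat L$, where $\overline\Omega$ is the complex vector space of $\mathbb C$-antilinear maps $V\to\mathbb C$ and $\widehat L=\{\ell\in\overline\Omega\mid \mathrm{Im}\,\ell(L)\subseteq\mathbb Z\}$. The isogeny $\lambda_H\colon T\to\widehat T$ is the one with analytic representation $V\to\overline\Omega$, $v\mapsto H(v,\cdot)$. *)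

(* Defs.v *)
From HB Require Import structures.
From mathcomp Require Import all_boot all_order all_algebra.
From mathcomp Require Import perm complex ring.
From mathcomp Require Import all_classical all_reals.

Set Implicit Arguments.
Unset Strict Implicit.
Unset Printing Implicit Defensive.

Import Order.TTheory GRing.Theory Num.Theory.
Local Open Scope ring_scope.

Definition increasing_idx (k m : nat) (p : {ffun 'I_k -> 'I_m}) : bool :=
  [forall i : 'I_k, forall j : 'I_k, (i < j)%N ==> (p i < p j)%N].

(* For k = 0 the only minor is the empty determinant, so the value is 1; if all
   minors of order k vanish (in particular if there are none), it is 0. *)
Definition detdiv (m n : nat) (M : 'M[int]_(m, n)) (k : nat) : nat :=
  \big[gcdn/0%N]_(p : {ffun 'I_k -> 'I_m} | increasing_idx p)
   \big[gcdn/0%N]_(q : {ffun 'I_k -> 'I_n} | increasing_idx q)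
    `|\det (mxsub p q M)|%N.

Lemma increasing_idxP (k m : nat) (p : {ffun 'I_k -> 'I_m}) :
  reflect (forall i j : 'I_k, (i < j)%N -> (p i < p j)%N) (increasing_idx p).
Proof.
apply: (iffP forallP) => [h i j ij|h i].
  by have /forallP/(_ j)/implyP := h i; apply.
by apply/forallP => j; apply/implyP; exact: h.
Qed.

Lemma dvdn_detdiv (m n : nat) (M : 'M[int]_(m, n)) (k d : nat) :
  (d %| detdiv M k)%N <->
  forall (p : {ffun 'I_k -> 'I_m}) (q : {ffun 'I_k -> 'I_n}),
    increasing_idx p -> increasing_idx q -> (d %| `|\det (mxsub p q M)|)%N.
Proof.
split=> [/dvdn_biggcdP h p q ip iq|h].
  by have /dvdn_biggcdP := h p ip; apply.
by apply/dvdn_biggcdP => p ip; apply/dvdn_biggcdP => q iq; exact: h.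
Qed.

Lemma detdiv_dvdS (m n : nat) (M : 'M[int]_(m, n)) (k : nat) :
  (detdiv M k %| detdiv M k.+1)%N.
Proof.
apply/dvdn_detdiv => p q /increasing_idxP ip /increasing_idxP iq.
rewrite (expand_det_row _ ord0).
suff: (detdiv M k %| \sum_j mxsub p q M ord0 j * cofactor (mxsub p q M) ord0 j)%Z by [].
apply: rpred_sum => j _; apply/dvdz_mull/dvdz_mull.
pose p' := [ffun i : 'I_k => p (lift ord0 i)].
pose q' := [ffun i : 'I_k => q (lift j i)].
have -> : row' ord0 (col' j (mxsub p q M)) = mxsub p' q' M.
  by apply/matrixP => a b; rewrite !mxE !ffunE.
have lift_lt (h : 'I_k.+1) (a b : 'I_k) : (a < b)%N -> (lift h a < lift h b)%N.
  by move=> ab; rewrite /= ltnNge leq_bump2 -ltnNge.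
have /(dvdn_detdiv M k)/(_ p' q') := dvdnn (detdiv M k); apply.
  by apply/increasing_idxP => a b ab; rewrite !ffunE; apply/ip/lift_lt.
by apply/increasing_idxP => a b ab; rewrite !ffunE; apply/iq/lift_lt.
Qed.

Lemma sort_idx (k m : nat) (p : {ffun 'I_k -> 'I_m}) : injective p ->
  exists s : 'S_k, increasing_idx [ffun i => p (s i)].
Proof.
move=> pI; pose t := [tuple p i | i < k]; pose r : rel 'I_m := fun x y => (x <= y)%N.
have /tuple_permP[s sE] : perm_eq (sort r t) t by rewrite perm_sort.
exists s; apply/increasing_idxP => i j ij; rewrite !ffunE.
have srt : sorted r (sort r t) by apply: sort_sorted => x y; exact: leq_total.
have nthE (a : 'I_k) : nth (p i) (sort r t) a = p (s a).
  by rewrite sE -(tnth_nth _ [tuple tnth t (s i0) | i0 < k]) !tnth_mktuple.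
have : r (p (s i)) (p (s j)).
  rewrite -!nthE; apply: (sorted_leq_nth _ _ _ srt).
  - by move=> y x z; exact: leq_trans.
  - by move=> x; exact: leqnn.
  - by rewrite inE size_sort size_tuple.
  - by rewrite inE size_sort size_tuple.
  - exact: ltnW.
rewrite /r leq_eqVlt => /orP[/eqP/val_inj/pI/perm_inj ij'|//].
by rewrite ij' ltnn in ij.
Qed.

Lemma detdiv_dvd_minor (m n : nat) (M : 'M[int]_(m, n)) (k : nat)
    (p : {ffun 'I_k -> 'I_m}) (q : {ffun 'I_k -> 'I_n}) :
  (detdiv M k %| `|\det (mxsub p q M)|)%N.
Proof.
have [/injectiveP pI|] := boolP (injectiveb p); last first.
  case/injectivePn => i [j ij pij]; rewrite (determinant_alternate ij) ?dvdn0 //.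
  by move=> a; rewrite !mxE pij.
have [/injectiveP qI|] := boolP (injectiveb q); last first.
  case/injectivePn => i [j ij qij]; rewrite -det_tr (determinant_alternate ij) ?dvdn0 //.
  by move=> a; rewrite !mxE qij.
have [s ps] := sort_idx pI; have [t qt] := sort_idx qI.
have /(dvdn_detdiv M k)/(_ _ _ ps qt) := dvdnn (detdiv M k).
have -> : mxsub [ffun i => p (s i)] [ffun i => q (t i)] M =
    row_perm s (col_perm t (mxsub p q M)).
  by apply/matrixP => a b; rewrite !mxE !ffunE.
by rewrite row_permE col_permE !det_mulmx !det_perm !abszM !abszX !exp1n mul1n muln1.
Qed.

Lemma det_mulmx_rowsub (m k : nat) (A : 'M[int]_(k, m)) (B : 'M[int]_(m, k)) :
  \det (A *m B) =
  \sum_(f : {ffun 'I_k -> 'I_m}) (\prod_i A i (f i)) * \det (rowsub f B).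
Proof.
rewrite /determinant.
under eq_bigr => s _.
  under eq_bigr => i _ do rewrite mxE.
  rewrite bigA_distr_bigA big_distrr /=.
  over.
rewrite exchange_big /=; apply: eq_bigr => f _.
rewrite big_distrr /=; apply: eq_bigr => s _.
rewrite big_split /= mulrCA; congr (_ * (_ * _)).
by apply: eq_bigr => i _; rewrite mxE.
Qed.

Lemma detdiv_tr (m n : nat) (M : 'M[int]_(m, n)) (k : nat) :
  detdiv M^T k = detdiv M k.
Proof.
have H m' n' (N : 'M[int]_(m', n')) : (detdiv N k %| detdiv N^T k)%N.
  apply/dvdn_detdiv => p q _ _; rewrite -det_tr.
  have -> : (mxsub p q N^T)^T = mxsub q p N by apply/matrixP => a b; rewrite !mxE.
  exact: detdiv_dvd_minor.
by apply/eqP; rewrite eqn_dvd H -{2}(trmxK M) H.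
Qed.

Lemma detdiv_mull (l m n : nat) (P : 'M[int]_(l, m)) (M : 'M[int]_(m, n)) (k : nat) :
  (detdiv M k %| detdiv (P *m M) k)%N.
Proof.
apply/dvdn_detdiv => p q _ _.
have -> : mxsub p q (P *m M) = rowsub p P *m colsub q M.
  by apply/matrixP => a b; rewrite !mxE; apply: eq_bigr => c _; rewrite !mxE.
rewrite det_mulmx_rowsub.
set S := \sum_(_ : _) _; suff: (detdiv M k %| S)%Z by [].
apply: rpred_sum => f _; apply: dvdz_mull.
have -> : rowsub f (colsub q M) = mxsub f q M by apply/matrixP => a b; rewrite !mxE.
exact: detdiv_dvd_minor.
Qed.

Lemma detdiv_mulr (l m n : nat) (M : 'M[int]_(m, n)) (Q : 'M[int]_(n, l)) (k : nat) :
  (detdiv M k %| detdiv (M *m Q) k)%N.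
Proof. by rewrite -(detdiv_tr M) -(detdiv_tr (M *m Q)) trmx_mul detdiv_mull. Qed.

Section Lattices.
Variables (R : realType) (V : vectType R[i]).

Definition is_zbasis (L : {pred V}) (n : nat) (b : 'I_n -> V) : Prop :=
  (forall i, b i \in L) /\
  (forall v, v \in L -> exists! c : 'cV[int]_n, v = \sum_i b i *~ c i 0).

(* Coordinates in a basis of V carry the usual topology of V, so this says that
   the points of L are isolated in L. The bound e, being positive, is real. *)
Definition is_discrete (L : {pred V}) : Prop :=
  forall v, v \in L -> exists2 e : R[i], 0 < e &
    forall w, w \in L ->
      (forall i, `|coord (vbasis {:V}) i (w - v)| < e) -> w = v.

Definition real_spanning (L : {pred V}) : Prop :=
  forall v, exists n (l : 'I_n -> V) (r : 'I_n -> R),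
    (forall i, l i \in L) /\ v = \sum_i (r i)%:C%C *: l i.

(* The real rank 2g is written g + g to fit block matrices. *)
Definition is_lattice (L : zmodClosed V) : Prop :=
  [/\ is_discrete L,
      exists b : 'I_(\dim {:V} + \dim {:V}) -> V, is_zbasis L b
    & real_spanning L].

Definition zcoord (n : nat) (b : 'I_n -> V) (v : V) : 'cV[int]_n :=
  xget 0 [set c : 'cV[int]_n | v = \sum_i b i *~ c i 0]%classic.

End Lattices.

Section ZCoord.
Variables (R : realType) (V : vectType R[i]) (L : zmodClosed V).
Variables (n : nat) (b : 'I_n -> V).
Hypothesis bL : is_zbasis L b.

Lemma zcoordK v : v \in L -> v = \sum_i b i *~ zcoord b v i 0.
Proof. by case: bL => _ /[apply] -[c [cE _]]; exact: (@xgetPex _ 0 [set d : 'cV[int]_n | v = \sum_i b i *~ d i 0]%classic (ex_intro _ c cE)). Qed.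

Lemma zcoord_eq (c : 'cV[int]_n) : zcoord b (\sum_i b i *~ c i 0) = c.
Proof.
set v := \sum_i _.
have vL : v \in L by apply: rpred_sum => i _; rewrite rpredMz // (proj1 bL).
case: bL => _ /(_ v vL)[c' [_ uniq_c]].
by rewrite -(uniq_c _ (zcoordK vL)) (uniq_c c).
Qed.

Lemma zcoord_sum m (a : 'I_m -> V) (c : 'cV[int]_m) : (forall i, a i \in L) ->
  zcoord b (\sum_i a i *~ c i 0) = (\matrix_(i, j) zcoord b (a j) i 0) *m c.
Proof.
move=> aL; rewrite -[RHS]zcoord_eq; congr zcoord.
under eq_bigr => i _ do rewrite {1}(zcoordK (aL i)) mulrz_suml.
rewrite exchange_big /=; apply: eq_bigr => j _.
rewrite mxE mulrz_sumr; apply: eq_bigr => i _.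
by rewrite mxE mulrzA.
Qed.
End ZCoord.

Record complexTorus (R : realType) := ComplexTorus {
  tspace :> vectType R[i];
  tlat : zmodClosed tspace;
  tlatP : is_lattice tlat
}.

(* The torus itself, as the quotient group V / L. *)
Definition tpoint (R : realType) (T : complexTorus R) : zmodType :=
  {ideal_quot (tlat T)}.

Definition tpi (R : realType) (T : complexTorus R) (v : T) : tpoint T :=
  (\pi_({ideal_quot (tlat T)}) v)%qT.

Definition tdim (R : realType) (T : complexTorus R) : nat := \dim {:tspace T}.

(* A homomorphism of tori is a homomorphism of the quotient groups induced by
   a C-linear map; the latter is unique and is recorded along. *)
Record torusHom (R : realType) (T1 T2 : complexTorus R) := TorusHom {
  thom :> {additive tpoint T1 -> tpoint T2};
  analytic_rep : {linear tspace T1 -> tspace T2};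
  analytic_repP : forall v, thom (tpi v) = tpi (analytic_rep v)
}.

Section HomOfRep.
Variables (R : realType) (T1 T2 : complexTorus R).
Variables (A : {linear tspace T1 -> tspace T2}).
Hypothesis AL : forall v, v \in tlat T1 -> A v \in tlat T2.

Let tpi_eq (T : complexTorus R) (u v : T) : tpi u = tpi v <-> u - v \in tlat T.
Proof.
rewrite /tpi; split=> [/eqP|uv]; last by apply/eqP; rewrite piE.
by rewrite piE.
Qed.

Definition hom_of_rep_fun (x : tpoint T1) : tpoint T2 := tpi (A (repr x)).

Let hom_of_rep_fun_tpi v : hom_of_rep_fun (tpi v) = tpi (A v).
Proof.
by apply/tpi_eq; rewrite -linearB; apply/AL/tpi_eq; rewrite /tpi reprK.
Qed.

Fact hom_of_rep_fun_additive : zmod_morphism hom_of_rep_fun.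
Proof.
move=> x y; rewrite -[x]reprK -[y]reprK -!/(tpi _).
have tpiB (T : complexTorus R) (u v : T) : tpi u - tpi v = tpi (u - v).
  by rewrite /tpi !piE.
by rewrite tpiB !hom_of_rep_fun_tpi linearB tpiB.
Qed.
HB.instance Definition _ := GRing.isZmodMorphism.Build (tpoint T1) (tpoint T2)
  hom_of_rep_fun hom_of_rep_fun_additive.

Definition hom_of_rep : torusHom T1 T2 := TorusHom hom_of_rep_fun_tpi.

End HomOfRep.

Section RationalRep.
Variable R : realType.

Definition rational_mx (T1 T2 : complexTorus R) (f : torusHom T1 T2)
    (b1 : 'I_(tdim T1 + tdim T1) -> T1) (b2 : 'I_(tdim T2 + tdim T2) -> T2) :
    'M[int]_(tdim T2 + tdim T2, tdim T1 + tdim T1) :=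
  \matrix_(i, j) zcoord b2 (analytic_rep f (b1 j)) i 0.

Lemma lattice_basis_subproof (T : complexTorus R) :
  {b : 'I_(tdim T + tdim T) -> T | is_zbasis (tlat T) b}.
Proof. by apply: cid; case: (tlatP T). Qed.

Definition lattice_basis (T : complexTorus R) : 'I_(tdim T + tdim T) -> T :=
  sval (lattice_basis_subproof T).

Lemma lattice_basisP (T : complexTorus R) :
  is_zbasis (tlat T) (lattice_basis (T := T)).
Proof. exact: svalP. Qed.

(* The bases of the lattices are chosen once and for all; hom_detdivE below shows
   that the result is the same for any other choice. *)
Definition hom_detdiv (T1 T2 : complexTorus R) (f : torusHom T1 T2) (k : nat) : nat :=
  detdiv (rational_mx f (lattice_basis (T := T1)) (lattice_basis (T := T2))) k.

(* The division is exact by detdiv_dvdS. *)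
Definition hom_elemdiv (T1 T2 : complexTorus R) (f : torusHom T1 T2) (k : nat) : nat :=
  (hom_detdiv f k %/ hom_detdiv f k.-1)%N.

End RationalRep.

Section BasisIndep.
Variables (R : realType) (T1 T2 : complexTorus R) (f : torusHom T1 T2).

Lemma analytic_rep_lat v : v \in tlat T1 -> analytic_rep f v \in tlat T2.
Proof.
have tpi0 (T : complexTorus R) (u : T) : (tpi u == 0) = (u \in tlat T).
  have -> : 0 = tpi (0 : T) by rewrite /tpi piE.
  by rewrite /tpi piE Quotient.equivE subr0.
by rewrite -!tpi0 -analytic_repP => /eqP->; rewrite raddf0.
Qed.

Lemma rational_mx_basis b1 b2 c1 c2 k :
  is_zbasis (tlat T1) b1 -> is_zbasis (tlat T2) b2 ->
  is_zbasis (tlat T1) c1 -> is_zbasis (tlat T2) c2 ->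
  detdiv (rational_mx f b1 b2) k = detdiv (rational_mx f c1 c2) k.
Proof.
have dvd a1 a2 d1 d2 : is_zbasis (tlat T1) a1 -> is_zbasis (tlat T2) a2 ->
    is_zbasis (tlat T1) d1 -> is_zbasis (tlat T2) d2 ->
    (detdiv (rational_mx f a1 a2) k %| detdiv (rational_mx f d1 d2) k)%N.
  move=> a1L a2L d1L d2L.
  pose P := \matrix_(i, j) zcoord d2 (a2 j) i 0.
  pose Q := \matrix_(i, j) zcoord a1 (d1 j) i 0.
  suff -> : rational_mx f d1 d2 = P *m rational_mx f a1 a2 *m Q.
    exact: dvdn_trans (detdiv_mull _ _ _) (detdiv_mulr _ _ _).
  apply/matrixP => i j; rewrite -mulmxA [LHS]mxE.
  have -> : analytic_rep f (d1 j) =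
      \sum_l a2 l *~ (rational_mx f a1 a2 *m zcoord a1 (d1 j)) l 0.
    have dj := proj1 d1L j.
    rewrite {1}(zcoordK a1L dj) linear_sum /=.
    under eq_bigr => l _ do rewrite raddfMz.
    have aL l : analytic_rep f (a1 l) \in tlat T2 by apply/analytic_rep_lat/(proj1 a1L).
    rewrite -(zcoord_sum a2L _ aL) -(zcoordK a2L) //.
    by apply: rpred_sum => l _; rewrite rpredMz ?aL.
  rewrite (zcoord_sum d2L _ (proj1 a2L)) !mxE.
  apply: eq_bigr => l _; rewrite !mxE; congr (_ * _).
  by apply: eq_bigr => h _; rewrite !mxE.
by move=> *; apply/eqP; rewrite eqn_dvd !dvd.
Qed.
End BasisIndep.

Lemma hom_detdivE (R : realType) (T1 T2 : complexTorus R) (f : torusHom T1 T2) k b1 b2 :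
  is_zbasis (tlat T1) b1 -> is_zbasis (tlat T2) b2 ->
  hom_detdiv f k = detdiv (rational_mx f b1 b2) k.
Proof. by move=> b1L b2L; apply: rational_mx_basis => //; exact: lattice_basisP. Qed.

Section Antidual.
Variables (R : realType) (V : vectType R[i]).
Local Notation C := R[i].

(* C-antilinear maps V -> C, with pointwise operations. *)
Definition antidual : Type := {linear V -> C | (@conjc R) \; *%R}.
HB.instance Definition _ := Choice.on antidual.
Implicit Types l m : antidual.

Fact antidual_add_subproof l m :
  GRing.linear_for ((@conjc R) \; *%R) (fun v => l v + m v).
Proof. by move=> a u v; rewrite !linearP /= mulrDr addrACA. Qed.
Definition antidual_add l m : antidual :=
  HB.pack (fun v => l v + m v)
    (GRing.isLinear.Build _ _ _ _ (fun v => l v + m v) (antidual_add_subproof l m)).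

Fact antidual_scale_subproof a l :
  GRing.linear_for ((@conjc R) \; *%R) (fun v => a * l v).
Proof. by move=> b u v; rewrite !linearP /= mulrDr mulrCA. Qed.
Definition antidual_scale a l : antidual :=
  HB.pack (fun v => a * l v)
    (GRing.isLinear.Build _ _ _ _ (fun v => a * l v) (antidual_scale_subproof a l)).
Definition antidual0 : antidual := \0.
Definition antidual_opp l := antidual_scale (-1) l.


Lemma antidualP l m : (forall v, l v = m v) -> l = m.
Proof.
case: l m => f fP [g gP] /= fg.
have E : f = g by apply: funext.
move: fP; rewrite {f fg}E => fP.
case: fP => [[f1] [f2]]; case: gP => [[g1] [g2]].
by rewrite (Prop_irrelevance f1 g1) (Prop_irrelevance f2 g2).
Qed.

Fact antidual_addA : associative antidual_add.
Proof. by move=> l m n; apply: antidualP => v /=; rewrite addrA. Qed.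
Fact antidual_addC : commutative antidual_add.
Proof. by move=> l m; apply: antidualP => v /=; rewrite addrC. Qed.
Fact antidual_add0 : left_id antidual0 antidual_add.
Proof. by move=> l; apply: antidualP => v /=; rewrite add0r. Qed.
Fact antidual_addN : left_inverse antidual0 antidual_opp antidual_add.
Proof. by move=> l; apply: antidualP => v /=; rewrite mulN1r addNr. Qed.
HB.instance Definition _ := GRing.isZmodule.Build antidual
  antidual_addA antidual_addC antidual_add0 antidual_addN.

Fact antidual_scaleA a b l :
  antidual_scale a (antidual_scale b l) = antidual_scale (a * b) l.
Proof. by apply: antidualP => v /=; rewrite mulrA. Qed.
Fact antidual_scale1 : left_id 1 antidual_scale.
Proof. by move=> l; apply: antidualP => v /=; rewrite mul1r. Qed.
Fact antidual_scaleDr : right_distributive antidual_scale +%R.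
Proof. by move=> a l m; apply: antidualP => v /=; rewrite mulrDr. Qed.
Fact antidual_scaleDl l : {morph antidual_scale^~ l : a b / a + b}.
Proof. by move=> a b; apply: antidualP => v /=; rewrite mulrDl. Qed.
HB.instance Definition _ := GRing.Zmodule_isLmodule.Build C antidual
  antidual_scaleA antidual_scale1 antidual_scaleDr antidual_scaleDl.

Lemma antidualD l m v : (l + m) v = l v + m v. Proof. by []. Qed.
Lemma antidualZ a l v : (a *: l) v = a * l v. Proof. by []. Qed.
Lemma antidual0E v : (0 : antidual) v = 0. Proof. by []. Qed.
Lemma antidualN l v : (- l) v = - l v. Proof. exact: mulN1r. Qed.
Lemma antidual_sum I (r : seq I) P (F : I -> antidual) v :
  (\sum_(i <- r | P i) F i) v = \sum_(i <- r | P i) F i v.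
Proof. by elim/big_rec2: _ => [//|i a b _ <-]. Qed.
Lemma antidualMz l (n : int) v : (l *~ n) v = l v *~ n.
Proof.
have Mn k : (l *+ k) v = l v *+ k.
  by elim: k => [|k IH]; rewrite ?mulr0n // !mulrS antidualD IH.
case: n => n; first exact: Mn.
by rewrite !NegzE !mulrNz antidualN; congr (- _); exact: Mn.
Qed.

Let e (i : 'I_(\dim {:V})) : V := (vbasis {:V})`_i.

Let row_fun (r : 'rV[C]_(\dim {:V})) (v : V) : C :=
  \sum_i (coord (vbasis {:V}) i v)^*%C * r 0 i.

Fact antidual_row_subproof r :
  GRing.linear_for ((@conjc R) \; *%R) (row_fun r).
Proof.
move=> a u v /=; rewrite /row_fun mulr_sumr -big_split /=; apply: eq_bigr => i _.
by rewrite linearP /= rmorphD rmorphM mulrDl mulrA.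
Qed.
Definition antidual_row (r : 'rV[C]_(\dim {:V})) : antidual :=
  HB.pack (row_fun r) (GRing.isLinear.Build _ _ _ _ _ (antidual_row_subproof r)).

Fact antidual_vect_subproof : Vector.axiom (\dim {:V}) antidual.
Proof.
have fV : free (vbasis {:V}) by have /andP[] := vbasisP {:V}.
exists (fun l => \row_i l (e i)).
  by move=> a l m; apply/rowP => i; rewrite !mxE.
exists antidual_row.
- move=> l; apply: antidualP => v; rewrite /= /row_fun.
  rewrite [in RHS](coord_vbasis (memvf v)) linear_sum /=; apply: eq_bigr => i _.
  by rewrite linearZ /= mxE.
- move=> r; apply/rowP => j; rewrite mxE /= /row_fun (bigD1 j) //= big1 ?addr0.
    by rewrite /e coord_free // eqxx conjc1 mul1r.
  by move=> i ij; rewrite /e coord_free // eq_sym (negPf ij) conjc0 mul0r.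
Qed.
HB.instance Definition _ := Lmodule_hasFinDim.Build C antidual antidual_vect_subproof.

Lemma dim_antidual : \dim {:antidual} = \dim {:V}.
Proof. by rewrite dimvf. Qed.

End Antidual.

Section DualLattice.
Variables (R : realType) (V : vectType R[i]) (L : zmodClosed V).
Local Notation C := R[i].
Local Notation g := (\dim {:V}).

Definition dual_lattice : {pred antidual V} :=
  fun l => `[< forall x, x \in L -> complex.Im (l x) \is a Num.int >].

Lemma dual_latticeP (l : antidual V) :
  reflect (forall x, x \in L -> complex.Im (l x) \is a Num.int) (l \in dual_lattice).
Proof. exact: asboolP. Qed.

Let ImB (x y : C) : complex.Im (x - y) = complex.Im x - complex.Im y.
Proof. by case: x y => [a b] [c d]. Qed.
Let ImD (x y : C) : complex.Im (x + y) = complex.Im x + complex.Im y.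
Proof. by case: x y => [a b] [c d]. Qed.
Let ReD (x y : C) : complex.Re (x + y) = complex.Re x + complex.Re y.
Proof. by case: x y => [a b] [c d]. Qed.
Let ImZ (r : R) (x : C) : complex.Im (r%:C%C * x) = r * complex.Im x.
Proof. by case: x => [a b] /=; rewrite mul0r addr0. Qed.
Let ReZ (r : R) (x : C) : complex.Re (r%:C%C * x) = r * complex.Re x.
Proof. by case: x => [a b] /=; rewrite mul0r subr0. Qed.
Let Im_sum n (F : 'I_n -> C) : complex.Im (\sum_i F i) = \sum_i complex.Im (F i).
Proof. by elim/big_rec2: _ => [//|i a b _ <-]. Qed.
Let intC (z : int) : (z%:~R : C) = (z%:~R : R)%:C%C.
Proof. by rewrite rmorph_int. Qed.

Fact dual_lattice_zmod : zmod_closed dual_lattice.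
Proof.
split=> [|l m /dual_latticeP lL /dual_latticeP mL]; apply/dual_latticeP => x xL.
  by rewrite antidual0E /= rpred0.
by rewrite antidualD antidualN ImB rpredB ?lL ?mL.
Qed.
HB.instance Definition _ :=
  GRing.isZmodClosed.Build (antidual V) dual_lattice dual_lattice_zmod.

Let rc (v : V) : 'rV[R]_(g + g) :=
  row_mx (\row_i complex.Re (coord (vbasis {:V}) i v))
         (\row_i complex.Im (coord (vbasis {:V}) i v)).

Let rcD : {morph rc : u v / u + v}.
Proof.
move=> u v; rewrite /rc add_row_mx; congr row_mx; apply/rowP => i;
by rewrite !mxE linearD /= ?ReD ?ImD.
Qed.

Let rcZ (r : R) v : rc (r%:C%C *: v) = r *: rc v.
Proof.
rewrite /rc scale_row_mx; congr row_mx; apply/rowP => i;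
by rewrite !mxE linearZ /= ?ReZ ?ImZ.
Qed.

Let rc_sum n (F : 'I_n -> V) : rc (\sum_i F i) = \sum_i rc (F i).
Proof.
elim/big_rec2: _ => [|i a b _ <-]; last exact: rcD.
by rewrite -(scale0r 0) -[0 *: _]/(0%:C%C *: _) rcZ scale0r.
Qed.

Let rc_inj : injective rc.
Proof.
move=> u v /eq_row_mx[/rowP uv1 /rowP uv2].
rewrite (coord_vbasis (memvf u)) (coord_vbasis (memvf v)).
apply: eq_bigr => i _; congr (_ *: _).
by apply/eqP; rewrite eq_complex; apply/andP; split; apply/eqP;
  [have := uv1 i | have := uv2 i]; rewrite !mxE.
Qed.

Let rc_surj x : exists v, rc v = x.
Proof.
exists (\sum_i (lsubmx x 0 i +i* rsubmx x 0 i)%C *: (vbasis {:V})`_i).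
have fV : free (vbasis {:V}) by have /andP[] := vbasisP {:V}.
rewrite -[RHS]hsubmxK; congr row_mx; apply/rowP => i;
by rewrite mxE coord_sum_free.
Qed.

Section FromBasis.
Variable b : 'I_(g + g) -> V.
Hypotheses (bL : is_zbasis L b) (Lspan : real_spanning L).

Let B : 'M[R]_(g + g) := \matrix_i rc (b i).

Let rc_lat v : v \in L -> exists x, rc v = x *m B.
Proof.
case: bL => _ bc /bc [c [-> _]].
exists (\row_i (c i 0)%:~R).
rewrite rc_sum mulmx_sum_row; apply: eq_bigr => i _.
by rewrite rowK mxE -rcZ -intC scaler_int.
Qed.

Let B_unit : B \in unitmx.
Proof.
rewrite -row_full_unit -sub1mx; apply/row_subP => i.
have [v <-] := rc_surj (row i 1%:M).
have [n [l [r [lL ->]]]] := Lspan v.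
rewrite rc_sum summx_sub // => j _; rewrite rcZ scalemx_sub //.
by have [x ->] := rc_lat (lL j); exact: submxMl.
Qed.

Let m (j : 'I_(g + g)) (v : V) : R := (rc v *m invmx B) 0 j.

Let mD j : {morph m j : u v / u + v}.
Proof. by move=> u v; rewrite /m rcD mulmxDl mxE. Qed.

Let mZ j r v : m j (r%:C%C *: v) = r * m j v.
Proof. by rewrite /m rcZ -scalemxAl mxE. Qed.

Let mb i j : m j (b i) = (i == j)%:R.
Proof.
rewrite /m; have -> : rc (b i) = row i B by rewrite rowK.
by rewrite -row_mul mulmxV // !mxE.
Qed.

Let v_dec v : v = \sum_j (m j v)%:C%C *: b j.
Proof.
apply: rc_inj; rewrite rc_sum -[LHS]mulmx1 -(mulVmx B_unit) mulmxA.
by rewrite mulmx_sum_row; apply: eq_bigr => j _; rewrite rcZ rowK.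
Qed.

Let bd_fun j v : C := (- m j ('i%C *: v) +i* m j v)%C.

Let bd_subproof j : GRing.linear_for ((@conjc R) \; *%R) (bd_fun j).
Proof.
move=> a u v; rewrite /bd_fun /=.
have E (x : C) w : m j (x *: w) = complex.Re x * m j w + complex.Im x * m j ('i%C *: w).
  by rewrite [in LHS](complexE x) scalerDl mD ['i%C * _]mulrC -scalerA !mZ.
case: a => x y; rewrite !scalerDr !mD scalerA (E ('i%C * _)) (E (x +i* y)%C) /=.
by apply/eqP; rewrite eq_complex /=; apply/andP; split; apply/eqP; ring.
Qed.

Let bd j : antidual V :=
  HB.pack (bd_fun j) (GRing.isLinear.Build _ _ _ _ _ (bd_subproof j)).

Let Im_bd j v : complex.Im (bd j v) = m j v. Proof. by []. Qed.

Let Im_dec (l : antidual V) v :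
  complex.Im (l v) = \sum_j m j v * complex.Im (l (b j)).
Proof.
rewrite [in LHS](v_dec v) linear_sum Im_sum; apply: eq_bigr => j _.
by rewrite linearZ /= oppr0 ImZ.
Qed.

Let antidual_eqP (l k : antidual V) :
  (forall j, complex.Im (l (b j)) = complex.Im (k (b j))) -> l = k.
Proof.
move=> lk; have ImE v : complex.Im (l v) = complex.Im (k v).
  by rewrite !Im_dec; apply: eq_bigr => j _; rewrite lk.
have ReE (h : antidual V) v : complex.Re (h v) = - complex.Im (h ('i%C *: v)).
  by rewrite linearZ /=; case: (h v) => x y /=; ring.
apply: antidualP => v; apply/eqP; rewrite eq_complex !ReE !ImE !eqxx //.
Qed.

Let Im_comb (F : 'I_(g + g) -> R) (G : 'I_(g + g) -> antidual V) v :
  (forall j x, complex.Im (G j x) = F j * m j x) ->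
  complex.Im ((\sum_j G j) v) = \sum_j F j * m j v.
Proof. by move=> GE; rewrite antidual_sum Im_sum; apply: eq_bigr => j _. Qed.

Let bd_comb (F : 'I_(g + g) -> R) (G : 'I_(g + g) -> antidual V) i :
  (forall j x, complex.Im (G j x) = F j * m j x) ->
  complex.Im ((\sum_j G j) (b i)) = F i.
Proof.
move=> /Im_comb ->; rewrite (bigD1 i) //= big1 ?addr0 ?mb ?eqxx ?mulr1 //.
by move=> j ji; rewrite mb eq_sym (negPf ji) mulr0.
Qed.

Let ImMz (x : C) (z : int) : complex.Im (x *~ z) = z%:~R * complex.Im x.
Proof. by rewrite -mulrzl intC ImZ. Qed.

Lemma dual_zbasis : is_zbasis dual_lattice bd.
Proof.
case: bL => bL1 bL2; split=> [j|l /dual_latticeP lL].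
  apply/dual_latticeP => x /bL2[c [-> _]]; rewrite Im_bd.
  rewrite /m rc_sum mulmx_suml summxE rpred_sum // => i _.
  rewrite -scaler_int intC rcZ -scalemxAl mxE rpredM ?intr_int //.
  by rewrite -/(m j (b i)) mb natr_int.
pose G (c : 'cV[int]_(g + g)) j := bd j *~ c j 0.
have GE c j x : complex.Im (G c j x) = (c j 0)%:~R * m j x.
  by rewrite /G antidualMz ImMz.
have lE (c : 'cV[int]_(g + g)) :
    l = \sum_j bd j *~ c j 0 <-> forall j, complex.Im (l (b j)) = (c j 0)%:~R.
  split=> [-> j|h]; first by rewrite (bd_comb _ (GE c)).
  by apply: antidual_eqP => j; rewrite h (bd_comb _ (GE c)).
exists (\col_j Num.floor (complex.Im (l (b j)))); split.
  by apply/lE => j; rewrite mxE floorK //; exact/lL/bL1.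
move=> c /lE h; apply/colP => j; rewrite mxE h.
by rewrite intrKfloor.
Qed.

Lemma dual_spanning : real_spanning dual_lattice.
Proof.
move=> l; exists (g + g)%N, bd, (fun j => complex.Im (l (b j))); split.
  by case: dual_zbasis.
apply: antidual_eqP => i.
rewrite (@bd_comb (fun j => complex.Im (l (b j)))) // => j x.
by rewrite antidualZ ImZ.
Qed.

Lemma dual_discrete : is_discrete dual_lattice.
Proof.
pose ev i j : C := (vbasis {:antidual V})`_i (b j).
pose M : C := 1 + \sum_j \sum_(i < \dim {:antidual V}) `|(ev i j)|.
have S0 : 0 <= \sum_j \sum_(i < \dim {:antidual V}) `|(ev i j)|.
  by apply: sumr_ge0 => j _; apply: sumr_ge0.
have M0 : 0 < M by rewrite ltr_wpDr.
move=> l lL; exists M^-1; first by rewrite invr_gt0.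
move=> k kL small; apply/eqP; rewrite -subr_eq0; apply/eqP.
have : k - l \in dual_lattice by rewrite rpredB.
move: (k - l) small => {l lL k kL} u small /dual_latticeP uL.
apply: antidual_eqP => j; rewrite antidual0E /=; apply/eqP/negPn/negP => nz.
have := norm_intr_ge1 (uL _ (proj1 bL j)) nz; apply/negP; rewrite -ltNge.
have ltu : `|u (b j)| < 1.
  rewrite (coord_vbasis (memvf u)) antidual_sum.
  apply: le_lt_trans (ler_norm_sum _ _ _) _.
  have : \sum_(i < \dim {:antidual V}) `|ev i j| * M^-1 < 1.
    rewrite -mulr_suml ltr_pdivrMr // mul1r /M ltr_pwDl //.
    by rewrite (bigD1 j) //= lerDl; apply: sumr_ge0 => ? _; apply: sumr_ge0.
  apply: le_lt_trans; apply: ler_sum => i _.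
  rewrite antidualZ normrM mulrC ler_wpM2l //.
  exact/ltW/small.
have : complex.Im (u (b j)) ^+ 2 < 1.
  have := ltu; rewrite -(@ltr_pXn2r _ 2) ?nnegrE // expr1n -add_Re2_Im2.
  rewrite -[1]/(1%:C%C) ltcR; apply: le_lt_trans.
  by rewrite lerDr sqr_ge0.
by rewrite -real_normK ?num_real // expr_lt1.
Qed.

End FromBasis.

Lemma dual_lattice_lattice : is_lattice L -> is_lattice dual_lattice.
Proof.
case=> _ [b bL] Lspan; split.
- exact: (dual_discrete bL Lspan).
- by rewrite dim_antidual; eexists; exact: (dual_zbasis bL Lspan).
- exact: (dual_spanning bL Lspan).
Qed.

End DualLattice.

Section Polarizations.
Variable R : realType.
Implicit Types T : complexTorus R.

Definition dual_torus T : complexTorus R :=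
  ComplexTorus (dual_lattice_lattice (tlatP T)).

(* {dot _ for _} is the type of positive definite hermitian forms, linear in the
   first argument and conjugate-linear in the second. *)
Record polarization T := Polarization {
  pol_form :> {dot (tspace T) for @conjc R};
  pol_int : forall x y, x \in tlat T -> y \in tlat T ->
    complex.Im (pol_form x y) \is a Num.int
}.

(* d_1, ..., d_g are stored as the entries 0, ..., g - 1 of a sequence. *)
Definition has_type T (H : polarization T) (d : seq nat) : Prop :=
  let D : 'M[R]_(tdim T) := diag_mx (\row_k (nth 0%N d k)%:R) in
  [/\ size d = tdim T, all (ltn 0) d, sorted dvdn d
    & exists2 b : 'I_(tdim T + tdim T) -> T, is_zbasis (tlat T) b
      & \matrix_(i, j) complex.Im (H (b i) (b j)) = block_mx 0 D (- D) 0].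

Definition pol_type T (H : polarization T) : seq nat :=
  xget [::] [set d | has_type H d]%classic.

Definition exponent T (H : polarization T) : nat := last 0%N (pol_type H).

Section LambdaMap.
Variables (T : complexTorus R) (H : polarization T).

Definition lambda_fun (v : T) : dual_torus T := (H v : {linear _ -> _ | _}).

Fact lambda_fun_linear : linear lambda_fun.
Proof.
move=> a u v; apply: antidualP => w.
rewrite antidualD antidualZ /=; exact: linearPl.
Qed.
HB.instance Definition _ := GRing.isLinear.Build R[i] (tspace T)
  (tspace (dual_torus T)) *:%R lambda_fun lambda_fun_linear.

Lemma lambda_fun_lat v : v \in tlat T -> lambda_fun v \in tlat (dual_torus T).
Proof. by move=> vL; apply/dual_latticeP => x; exact: pol_int. Qed.

(* The isogeny with analytic representation v |-> H(v, .). *)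
Definition lambda : torusHom T (dual_torus T) := hom_of_rep lambda_fun_lat.

End LambdaMap.
End Polarizations.

(* Main.v *)
Require Import Defs.
From mathcomp Require Import all_boot all_order all_algebra.
From mathcomp Require Import complex all_classical all_reals.
From mathcomp Require Import perm zify.

Set Implicit Arguments.
Unset Strict Implicit.
Unset Printing Implicit Defensive.

Import Order.TTheory GRing.Theory Num.Theory.
Local Open Scope ring_scope.

(** Let b be a basis of the lattice L in which the imaginary part E of H has the
    matrix J with blocks 0, D, -D, 0. The form is nondegenerate, so its real
    inverse produces, from the functionals H(b_k, .), antilinear functionals c_j
    with Im c_j(b_i) = 1 if i = j and 0 otherwise. Such a family is a Z-basis of
    the dual lattice: an antilinear map is determined by its imaginary part, an
    R-linear functional, and that functional by its values on b. In this basis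
    the i-th coordinate of l is Im l(b_i), so the rational representation of
    lambda_H in the bases b and c is the transpose of J
    ([hom_detdiv_lambda]). Hence lambda_H and J have the same determinantal
    divisors.

    Permuting rows and columns, separately, turns J into a diagonal matrix with
    entries d_1, d_1, d_2, d_2, ... up to sign. Since each entry divides the next
    one, the k-th determinantal divisor is the absolute value of the leading
    principal minor of order k ([detdiv_diag], [detdiv_symplectic]). The quotient
    of those of orders 2k and 2k - 1 is the 2k-th entry, which is d_k. *)

(** * Determinantal divisors of symplectic matrices *)

Lemma detdiv_mxsub (m n m' n' k : nat) (M : 'M[int]_(m, n))
    (p : 'I_m' -> 'I_m) (q : 'I_n' -> 'I_n) :
  (detdiv M k %| detdiv (mxsub p q M) k)%N.
Proof.
apply/dvdn_detdiv => p' q' _ _.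
have -> : mxsub p' q' (mxsub p q M) =
    mxsub [ffun i => p (p' i)] [ffun i => q (q' i)] M.
  by apply/matrixP => a b; rewrite !mxE !ffunE.
exact: detdiv_dvd_minor.
Qed.

(** Only the absolute values of the minors matter, so rows and columns may be
    permuted independently of each other. *)
Lemma detdiv_permute (n k : nat) (M : 'M[int]_n) (p q : 'I_n -> 'I_n) :
  injective p -> injective q -> detdiv (mxsub p q M) k = detdiv M k.
Proof.
move=> /injF_bij[p' _ p'K] /injF_bij[q' _ q'K].
apply/eqP; rewrite eqn_dvd detdiv_mxsub andbT.
have {2}-> : M = mxsub p' q' (mxsub p q M).
  by apply/matrixP => i j; rewrite !mxE p'K q'K.
exact: detdiv_mxsub.
Qed.

Lemma increasing_idx_ge (k m : nat) (p : {ffun 'I_k -> 'I_m}) (i : 'I_k) :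
  increasing_idx p -> (i <= p i)%N.
Proof.
move=> /increasing_idxP ip; case: i => i; elim: i => [//|i IH] ik.
exact: leq_ltn_trans (IH (ltnW ik)) (ip (Ordinal (ltnW ik)) (Ordinal ik) (ltnSn i)).
Qed.

(** The row indices p of a minor are increasing, whence i <= p i. Every product in
    the Leibniz formula takes one entry from each row p i, and that entry is a
    multiple of e (p i), hence of e i; so the leading principal minor divides
    every other one. Signs of the diagonal entries are left free because the
    reordered symplectic matrix has both. *)
Lemma detdiv_diag (n k : nat) (M : 'M[int]_n) (e : nat -> nat) :
  (forall i j, `|M i j|%N = if i == j then e i else 0%N) ->
  (forall i j, (i <= j < n)%N -> (e i %| e j)%N) ->
  (k <= n)%N -> detdiv M k = (\prod_(i < k) e i)%N.
Proof.
move=> ME e_dvd le_kn; apply/eqP; rewrite eqn_dvd; apply/andP; split.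
  pose w := [ffun i : 'I_k => widen_ord le_kn i].
  suff -> : (\prod_(i < k) e i)%N = `|\det (mxsub w w M)|%N.
    exact: detdiv_dvd_minor.
  have -> : mxsub w w M = diag_mx (\row_i mxsub w w M i i).
    apply/matrixP => i j; rewrite !mxE !ffunE; have [<-//|ij] := eqVneq i j.
    apply/eqP; rewrite -absz_eq0 ME ifN //.
  rewrite det_diag; elim/big_rec2: _ => [//|i x y _ ->].
  by rewrite abszM !mxE !ffunE ME eqxx.
apply/dvdn_detdiv => p q ip _.
set x := \det _; suff: ((\prod_(i < k) e i)%N %| x)%Z by [].
apply: rpred_sum => s _; apply: dvdz_mull.
rewrite dvdzE /=.
have -> : `|(\prod_i mxsub p q M i (s i))%R|%N = (\prod_i `|mxsub p q M i (s i)|)%N.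
  by elim/big_rec2: _ => [//|i a b _ <-]; rewrite abszM.
apply: (@big_ind2 _ _ (fun a b => (a %| b)%N)) => // [*|i _]; first exact: dvdn_mul.
rewrite mxE ME; case: ifP => // _.
by rewrite e_dvd // ltn_ord increasing_idx_ge.
Qed.

Section Interleave.
Variable g : nat.

Fact half_ltn (i : 'I_(g + g)) : (i./2 < g)%N.
Proof. have := ltn_ord i; lia. Qed.

(** Position i receives index i./2 of one of the two halves, so that the two copies
    of each d_k become adjacent and the divisibility chain survives. Rows are listed
    with c = false and columns with c = true: the two listings start in opposite
    halves because the nonzero entries lie in the off-diagonal blocks. *)
Definition interleave (c : bool) (i : 'I_(g + g)) : 'I_(g + g) :=
  if odd i (+) c then rshift g (Ordinal (half_ltn i))
  else lshift g (Ordinal (half_ltn i)).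

Lemma interleave_inj c : injective (interleave c).
Proof.
move=> i j; rewrite /interleave => /(congr1 val) ij; apply: val_inj.
have := ltn_ord i; have := ltn_ord j.
by move: ij; case: c; rewrite ?addbT ?addbF;
  case: (boolP (odd i)); case: (boolP (odd j)) => /=; lia.
Qed.

Lemma detdiv_symplectic (d : nat -> nat) (k : nat) :
  (forall i j, (i <= j < g)%N -> (d i %| d j)%N) -> (k <= g + g)%N ->
  let D : 'M[int]_g := diag_mx (\row_i (d i)%:Z) in
  detdiv (block_mx 0 D (- D) 0) k = (\prod_(i < k) d i./2)%N.
Proof.
move=> d_dvd kg D.
rewrite -(detdiv_permute _ _ (@interleave_inj false) (@interleave_inj true)).
apply: (@detdiv_diag _ _ _ (fun i => d i./2)) => // [i j|i j ij]; last first.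
  by apply: d_dvd; lia.
rewrite mxE /interleave addbF addbT.
have -> : (i == j) =
    (odd i == odd j) && (Ordinal (half_ltn i) == Ordinal (half_ltn j)).
  by rewrite -!val_eqE /=; lia.
case: (odd i) (odd j) => [] [] /=;
  rewrite ?(block_mxEul, block_mxEur, block_mxEdl, block_mxEdr) !mxE //=.
  by rewrite abszN; case: eqP => //= ->; rewrite mulr1n.
by case: eqP => //= ->; rewrite mulr1n.
Qed.
End Interleave.

(** * The basis dual to a basis of the lattice *)

Section ImaginaryPart.
Variable R : realType.
Implicit Types (x y : R[i]) (r : R).

Lemma Im_sum (I : Type) (s : seq I) (F : I -> R[i]) :
  complex.Im (\sum_(i <- s) F i) = \sum_(i <- s) complex.Im (F i).
Proof. by elim/big_rec2: _ => [//|i x y _ <-]; case: (F i) y => [? ?] [? ?]. Qed.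

Lemma ImZ r x : complex.Im (r%:C%C * x) = r * complex.Im x.
Proof. by case: x => [a b] /=; rewrite mul0r addr0. Qed.

Lemma ImMz x (z : int) : complex.Im (x *~ z) = z%:~R * complex.Im x.
Proof. by rewrite -mulrzl -[z%:~R](rmorph_int (real_complex R)) ImZ. Qed.
End ImaginaryPart.

Section DualBasis.
Variables (R : realType) (V : vectType R[i]) (L : zmodClosed V).
Variables (n : nat) (b : 'I_n -> V).
Hypotheses (bL : is_zbasis L b) (Lspan : real_spanning L).

(** The real part is recovered from the imaginary one by
    Re h(v) = - Im h(iv), and Im h is R-linear, so it is determined on a set that
    spans V over the reals. *)
Lemma antidual_Im_eq (l m : antidual V) :
  (forall j, complex.Im (l (b j)) = complex.Im (m (b j))) -> l = m.
Proof.
move=> lm.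
have ImE v : complex.Im (l v) = complex.Im (m v).
  have [k [u [r [uL ->]]]] := Lspan v; rewrite !linear_sum /=.
  apply: eq_bigr => i _; rewrite !linearZ /= !oppr0 !ImZ; congr (_ * _).
  have [c [-> _]] := proj2 bL _ (uL i).
  rewrite !linear_sum /=; apply: eq_bigr => j _.
  by rewrite !raddfMz /= lm.
have ReE (h : antidual V) v : complex.Re (h v) = - complex.Im (h ('i%C *: v)).
  by rewrite linearZ /=; case: (h v) => x y /=; rewrite mul0r add0r mulN1r opprK.
by apply: antidualP => v; apply/eqP; rewrite eq_complex !ReE !ImE !eqxx.
Qed.

Variable c : 'I_n -> antidual V.
Hypothesis cb : forall i j, complex.Im (c j (b i)) = (i == j)%:R.

Lemma Im_dual_comb (z : 'cV[int]_n) i :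
  complex.Im ((\sum_j c j *~ z j 0) (b i)) = (z i 0)%:~R.
Proof.
rewrite antidual_sum Im_sum (bigD1 i) //= big1 ?addr0 => [|j ji];
  rewrite antidualMz ImMz cb ?eqxx ?mulr1 //.
by rewrite eq_sym (negPf ji) mulr0.
Qed.

(** The coordinates of l must be the numbers Im l(b_i), which are integers exactly
    when l is in the dual lattice. *)
Lemma is_zbasis_dual : is_zbasis (dual_lattice L) c.
Proof.
split=> [j|l /dual_latticeP lL].
  apply/dual_latticeP => x /(proj2 bL)[z [-> _]].
  rewrite linear_sum Im_sum rpred_sum // => i _.
  by rewrite raddfMz ImMz cb rpredM ?intr_int ?natr_int.
exists (\col_j Num.floor (complex.Im (l (b j)))); split.
  apply: antidual_Im_eq => i; rewrite Im_dual_comb mxE floorK //.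
  exact/lL/(proj1 bL).
by move=> z lz; apply/colP => i; rewrite mxE lz Im_dual_comb intrKfloor.
Qed.

Lemma zcoord_dual (l : antidual V) (i : 'I_n) : l \in dual_lattice L ->
  (zcoord c l i 0)%:~R = complex.Im (l (b i)).
Proof. by move=> lL; rewrite [in RHS](zcoordK is_zbasis_dual lL) Im_dual_comb. Qed.

End DualBasis.

(** The index types are left free, because the dimension of the dual torus is only
    provably equal to that of the torus. *)
Lemma hom_detdiv_zcoord (R : realType) (T1 T2 : complexTorus R) (f : torusHom T1 T2)
    (k n1 n2 : nat) (b1 : 'I_n1 -> T1) (b2 : 'I_n2 -> T2) :
  n1 = (tdim T1 + tdim T1)%N -> n2 = (tdim T2 + tdim T2)%N ->
  is_zbasis (tlat T1) b1 -> is_zbasis (tlat T2) b2 ->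
  hom_detdiv f k = detdiv (\matrix_(i, j) zcoord b2 (analytic_rep f (b1 j)) i 0) k.
Proof. by move=> n1E n2E; subst n1 n2; exact: hom_detdivE. Qed.

(** * The matrix of the isogeny induced by a polarization *)

Section LambdaMatrix.
Variables (R : realType) (T : complexTorus R) (H : polarization T).

(** The dual basis is built from the functionals H(b_i, .) themselves, by inverting
    M over the reals. The i-th coordinate of H(b_j, .) in it is Im H(b_j, b_i), so
    the rational representation is the transpose of M. *)
Lemma hom_detdiv_lambda (b : 'I_(tdim T + tdim T) -> T) (M : 'M[int]_(tdim T + tdim T)) k :
  is_zbasis (tlat T) b ->
  \matrix_(i, j) complex.Im (H (b i) (b j)) = map_mx intr M :> 'M[R]__ ->
  map_mx intr M \in @unitmx R _ ->
  hom_detdiv (lambda H) k = detdiv M k.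
Proof.
move=> bL EM Mu; have [_ _ Lspan] := tlatP T.
pose c j : antidual (tspace T) :=
  \sum_i (invmx (map_mx intr M) j i)%:C%C *: lambda_fun H (b i).
have cb i j : complex.Im (c j (b i)) = (i == j)%:R.
  rewrite antidual_sum Im_sum eq_sym.
  transitivity ((1%:M : 'M[R]_(tdim T + tdim T)) j i); last by rewrite mxE.
  rewrite -(mulVmx Mu) mxE; apply: eq_bigr => l _.
  by rewrite antidualZ ImZ -EM !mxE.
have cL := is_zbasis_dual bL Lspan cb.
have dim_dual : (tdim T + tdim T = tdim (dual_torus T) + tdim (dual_torus T))%N.
  by rewrite /tdim dim_antidual.
rewrite (@hom_detdiv_zcoord R T (dual_torus T) _ _ _ _ b c erefl dim_dual bL cL).
rewrite -[RHS]detdiv_tr; congr detdiv; apply/matrixP => i j; rewrite !mxE.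
apply/(mulrIz (oner_neq0 R)); rewrite (zcoord_dual bL Lspan cb); last first.
  exact/lambda_fun_lat/(proj1 bL).
by move/matrixP/(_ j i): EM; rewrite !mxE.
Qed.
End LambdaMatrix.

Lemma symplectic_unitmx (F : fieldType) (g : nat) (D : 'M[F]_g) :
  D \in unitmx -> block_mx 0 D (- D) 0 \in unitmx.
Proof.
move=> Du; have [] // := @mulmx1_unit _ _ (block_mx 0 D (- D) 0)
  (block_mx 0 (- invmx D) (invmx D) 0).
rewrite mulmx_block !mul0mx !mulmx0 mulmxN mulNmx opprK mulmxV //.
by rewrite !add0r !addr0 -scalar_mx_block.
Qed.

Lemma has_type_elemdiv (R : realType) (T : complexTorus R) (H : polarization T)
    (d : seq nat) (k : nat) : has_type H d -> (k < tdim T)%N ->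
  nth 0%N d k = hom_elemdiv (lambda H) (2 * k.+1).
Proof.
case=> szd /(all_nthP 0%N) d_pos d_dvd [b bL Eb] kg.
have d_gt0 i : (i < tdim T)%N -> (0 < nth 0%N d i)%N by rewrite -szd; exact: d_pos.
pose D : 'M[int]_(tdim T) := diag_mx (\row_i (nth 0%N d i)%:Z).
pose D' : 'M[R]_(tdim T) := diag_mx (\row_i (nth 0%N d i)%:R).
have DE : map_mx intr D = D'.
  by apply/matrixP => i j; rewrite !mxE rmorphMn.
have ME : map_mx intr (block_mx 0 D (- D) 0) = block_mx 0 D' (- D') 0.
  by rewrite map_block_mx map_mxN !map_mx0 DE.
have D'u : D' \in unitmx.
  rewrite unitmxE det_diag unitfE; apply/prodf_neq0 => i _.
  by rewrite mxE pnatr_eq0 -lt0n d_gt0.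
have dvd_d i j : (i <= j < tdim T)%N -> (nth 0%N d i %| nth 0%N d j)%N.
  case/andP => ij jg.
  by apply: (sorted_leq_nth dvdn_trans dvdnn) => //;
    rewrite inE szd // (leq_ltn_trans ij).
have detdivE l : (l <= tdim T + tdim T)%N ->
    hom_detdiv (lambda H) l = (\prod_(i < l) nth 0%N d i./2)%N.
  move=> lg; rewrite -(detdiv_symplectic dvd_d lg).
  apply: hom_detdiv_lambda bL _ _; rewrite ME //.
  exact: symplectic_unitmx.
rewrite /hom_elemdiv mulnS mul2n !detdivE; try lia.
rewrite big_ord_recr /= uphalf_double mulKn // prodn_gt0 // => i.
by apply: d_gt0; have := ltn_ord i; lia.
Qed.

Theorem proposition11 (R : realType) (T : complexTorus R) (g : nat)
    (hg : tdim T = g) (g_ge1 : (1 <= g)%N) (H : polarization T)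
    (d : seq nat) (Hd : has_type H d) :
  (forall k, (1 <= k <= g)%N ->
     nth 0%N d k.-1 = hom_elemdiv (lambda H) (2 * k)) /\
  exponent H = hom_elemdiv (lambda H) (2 * g).
Proof.
subst g; split=> [[//|k] /andP[_ kg]|]; first exact: has_type_elemdiv.
(* The exponent is read off a chosen type of H, which need not be d a priori; the
   first part is applied to that one. *)
have Hp : has_type H (pol_type H).
  exact: (@xgetPex _ [::] [set e | has_type H e]%classic (ex_intro _ d Hd)).
have [szp _ _ _] := Hp.
rewrite /exponent -nth_last szp (has_type_elemdiv Hp) ?prednK //.
Qed.
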